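(* Let $a,b,c,d$ be nonnegative integers with $a\le b$ and $a<c\le d$. If $n$ is sufficiently large, then $\mathrm{ex}(n,S_{a,b},S_{c,d})=\mathcal{N}(S_{a,b},K_{c,n-c})$.
   Context: The double star $S_{a,b}$ is the tree consisting of an edge $uv$, $a$ leaves adjacent to $u$ and $b$ leaves adjacent to $v$. $\mathcal{N}(H,G)$ is the number of copies of $H$ in $G$; $\mathrm{ex}(n,H,F)$ is the maximum of $\mathcal{N}(H,G)$ over $n$-vertex graphs $G$ containing no copy of $F$. $K_{c,n-c}$ is the complete bipartite graph with parts of sizes $c$ and $n-c$.
   Formalization: The case a = b = 0 is excluded by assuming b ≥ 1: there S_{0,0} is a single edge, and for n divisible by c+d+1 disjoint copies of K_{c+d+1} are S_{c,d}-free with more edges than K_{c,n-c}, so the claim fails for all such c, d. *)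

(* Defs.v *)
From HB Require Import structures.
From mathcomp Require Import all_boot.

Set Implicit Arguments.
Unset Strict Implicit.
Unset Printing Implicit Defensive.

(* A finite simple graph on the vertex type T, given by its edge set. *)
Record sgraph (T : finType) := SGraph {
  edges : {set {set T}};
  edges_card2 : [forall e in edges, #|e| == 2]
}.

HB.instance Definition _ (T : finType) := [isSub for @edges T].
HB.instance Definition _ (T : finType) := [Finite of sgraph T by <:].

(* The pair (W, D) is a subgraph of G with vertex set W and edge set D that is
   isomorphic to H, through f : V(H) -> W; that every edge in D is contained
   in W follows from D being the image of the edge set of H. *)
Definition is_copy (U T : finType) (H : sgraph U) (G : sgraph T)
    (S : {set T} * {set {set T}}) : bool :=
  (S.2 \subset edges G) &&
  [exists f : {ffun U -> T},
    [&& injectiveb f, S.1 == [set f x | x : U]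
      & S.2 == [set [set f x | x in e] | e : {set U} in edges H]]].

Definition copies (U T : finType) (H : sgraph U) (G : sgraph T) :
  {set {set T} * {set {set T}}} := [set S | is_copy H G S].

Definition ncopies (U T : finType) (H : sgraph U) (G : sgraph T) : nat :=
  #|copies H G|.

Definition copy_free (U T : finType) (F : sgraph U) (G : sgraph T) : bool :=
  copies F G == set0.

Definition gen_ex (n : nat) (U V : finType) (H : sgraph U) (F : sgraph V) : nat :=
  \max_(G : sgraph 'I_n | copy_free F G) ncopies H G.

(* Vertices of the double star S_{a,b}: inl false is u, inl true is v,
   inr (inl i) are the leaves at u and inr (inr j) the leaves at v. *)
Definition dstar_vertex (a b : nat) : finType := (bool + ('I_a + 'I_b))%type.

Definition dstar_edges (a b : nat) : {set {set dstar_vertex a b}} :=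
  [set inl false; inl true]
  |: ([set [set inl false; inr (inl i)] | i : 'I_a]
      :|: [set [set inl true; inr (inr j)] | j : 'I_b]).

Lemma dstar_edges_card2 (a b : nat) :
  [forall e in dstar_edges a b, #|e| == 2].
Proof.
apply/forall_inP => e; rewrite !inE => /orP[/eqP-> |]; first by rewrite cards2.
by case/orP => /imsetP[i _ ->]; rewrite cards2.
Qed.

Definition dstar (a b : nat) : sgraph (dstar_vertex a b) :=
  SGraph (dstar_edges_card2 a b).

Definition Kbip_edges (m k : nat) : {set {set ('I_m + 'I_k)%type}} :=
  [set [set inl i; inr j] | i : 'I_m, j : 'I_k].

Lemma Kbip_edges_card2 (m k : nat) : [forall e in Kbip_edges m k, #|e| == 2].
Proof. by apply/forall_inP => e /imset2P[i j _ _ ->]; rewrite cards2. Qed.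

Definition Kbip (m k : nat) : sgraph ('I_m + 'I_k)%type :=
  SGraph (Kbip_edges_card2 m k).

(* Main.v *)
Require Import Defs.
From mathcomp Require Import all_boot zify.

Set Implicit Arguments.
Unset Strict Implicit.
Unset Printing Implicit Defensive.

(** Every copy of [H] in [G] is the image of exactly [|Aut H|] embeddings, so
copies may be replaced by embeddings throughout. Choosing the centres and then
the leaves, the number of embeddings of [S_{a,b}] in [G] is at most the sum over
ordered edges [(u, v)] of [(deg u - 1)^_a * (deg v - 1)^_b], with equality when
[G] is triangle-free.

Let [G] be [S_{c,d}]-free and call a vertex big if its degree exceeds [c + d].
A neighbour of a big vertex has degree at most [c], since otherwise [S_{c,d}]
could be built greedily; in particular the big vertices are independent. If there
are [q] small vertices, an edge between a small and a big vertex contributes at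
most [W q], its contribution in [K_{c,q}], and an edge between small vertices
contributes [O(1)]. Charging all edges to their small ends, a small vertex with [r]
big neighbours contributes at most [r * W q + (c - r) * O(1)] if [r > 0], and [O(1)]
if [r = 0]. With at least [c] big vertices, [q <= n - c] and the total is at most
[q * c * W q] unless [W q], hence [q], is bounded. With fewer than [c] big vertices,
[r <= c - 1] and the loss of a factor [(c - 1) / c] is decisive for large [n]. *)

(** * Copies as orbits of embeddings under automorphisms *)

Section Embeddings.
Variables (U T : finType) (H : sgraph U) (G : sgraph T).

Definition embeddings : {set {ffun U -> T}} :=
  [set f : {ffun U -> T} | injectiveb f & [forall e in edges H, f @: e \in edges G]].

Lemma embeddingsP (f : {ffun U -> T}) :
  reflect (injective f /\ forall e, e \in edges H -> f @: e \in edges G)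
          (f \in embeddings).
Proof.
rewrite inE; apply: (iffP andP) => -[].
  by move=> /injectiveP fI /forall_inP fE.
by move=> fI fE; split; [apply/injectiveP | apply/forall_inP].
Qed.

Definition embedding_image (f : {ffun U -> T}) : {set T} * {set {set T}} :=
  ([set f x | x : U], [set f @: e | e : {set U} in edges H]).

Lemma copiesE : copies H G = embedding_image @: embeddings.
Proof.
apply/setP => S; rewrite inE; apply/andP/imsetP.
  case=> /subsetP sub /existsP[f /and3P[/injectiveP fI /eqP S1 /eqP S2]].
  exists f; last by case: S S1 S2 {sub} => S1 S2 /= -> ->.
  by apply/embeddingsP; split=> // e eH; apply: sub; rewrite S2 imset_f.
case=> f /embeddingsP[fI fE] ->; split=> /=.
  by apply/subsetP => _ /imsetP[e eH ->]; apply: fE.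
by apply/existsP; exists f; rewrite !eqxx !andbT; apply/injectiveP.
Qed.

End Embeddings.

Section Composition.
Variables (U T : finType) (H : sgraph U).

Lemma imset_ffun_comp (V : finType) (f : {ffun U -> T}) (g : V -> U) (e : {set V}) :
  [ffun x => f (g x)] @: e = f @: (g @: e).
Proof. by rewrite -imset_comp; apply: eq_imset => x; rewrite ffunE. Qed.

(** An injective vertex map is injective on sets, so it sends the finite set [edges H] into itself
    without loss. *)
Lemma automorphism_edges (s : {ffun U -> U}) :
  s \in embeddings H H -> [set s @: e | e : {set U} in edges H] = edges H.
Proof.
case/embeddingsP=> sI sE; apply/eqP; rewrite eqEcard.
rewrite card_imset ?leqnn; last exact: imset_inj.
by rewrite andbT; apply/subsetP => _ /imsetP[e eH ->]; apply: sE.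
Qed.

(** Embeddings with the same image as [f] factor through [f]. Since [f] is also injective on edges,
    the factor is an automorphism. *)
Lemma embedding_fiber (G : sgraph T) (f : {ffun U -> T}) : f \in embeddings H G ->
  [set g in embeddings H G | embedding_image H g == embedding_image H f]
    = (fun s : {ffun U -> U} => [ffun x => f (s x)]) @: embeddings H H.
Proof.
case/embeddingsP=> fI fE; apply/setP => g; rewrite inE; apply/andP/imsetP.
  case=> /embeddingsP[gI gE] /eqP[img1 img2].
  have gP x : exists y, f y == g x.
    have : g x \in [set f y | y : U] by rewrite -img1 imset_f.
    by case/imsetP=> y _ ->; exists y.
  pose s := [ffun x => xchoose (gP x)].
  have fs x : f (s x) = g x by rewrite ffunE; apply/eqP; exact: (xchooseP (gP x)).
  exists s; last by apply/ffunP => x; rewrite ffunE fs.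
  apply/embeddingsP; split=> [x y sxy|e eH].
    by apply: gI; rewrite -!fs sxy.
  have : g @: e \in [set f @: e' | e' : {set U} in edges H].
    by rewrite -img2 imset_f.
  case/imsetP=> e' e'H; have -> : g @: e = f @: (s @: e).
    by rewrite -imset_comp; apply: eq_imset => x /=; rewrite fs.
  by move/(imset_inj fI) ->.
case=> s sA ->; have /embeddingsP[sI sE] := sA; split.
  apply/embeddingsP; split=> [x y|e eH].
    by rewrite !ffunE => /fI /sI.
  by rewrite imset_ffun_comp; apply/fE/sE.
apply/eqP; congr (_, _).
  (* Both vertex images have [#|U|] elements, so one inclusion suffices. *)
  apply/eqP; rewrite eqEcard !card_imset // ?leqnn ?andbT; last first.
    by move=> x y; rewrite !ffunE => /fI /sI.
  by apply/subsetP => _ /imsetP[x _ ->]; rewrite ffunE imset_f.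
rewrite -{2}(automorphism_edges sA) -imset_comp.
by apply: eq_imset => e /=; rewrite imset_ffun_comp.
Qed.

Lemma ncopies_mul_automorphisms (G : sgraph T) :
  ncopies H G * #|embeddings H H| = #|embeddings H G|.
Proof.
rewrite /ncopies copiesE -sum_nat_const -[RHS]sum1_card.
rewrite [RHS](partition_big_imset (embedding_image H)) /=.
apply: eq_bigr => _ /imsetP[f fE ->].
rewrite sum1dep_card (embedding_fiber fE) card_imset //.
move=> s t /ffunP st; apply/ffunP => x; have := st x; rewrite !ffunE.
by have /embeddingsP[fI _] := fE; apply: fI.
Qed.

Lemma automorphisms_gt0 : 0 < #|embeddings H H|.
Proof.
apply/card_gt0P; exists [ffun x => x]; apply/embeddingsP; split=> [x y|e].
  by rewrite !ffunE.
suff -> : [ffun x => x] @: e = e by [].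
by rewrite -[RHS]imset_id; apply: eq_imset => x; rewrite ffunE.
Qed.

Lemma copy_freeE (G : sgraph T) : copy_free H G = (#|embeddings H G| == 0).
Proof.
by rewrite -ncopies_mul_automorphisms muln_eq0 (gtn_eqF automorphisms_gt0)
  orbF cards_eq0.
Qed.

End Composition.

Lemma leq_embeddings (U T T' : finType) (H : sgraph U) (G : sgraph T)
    (G' : sgraph T') (h : T -> T') : injective h ->
    (forall e, e \in edges G -> h @: e \in edges G') ->
  #|embeddings H G| <= #|embeddings H G'|.
Proof.
move=> hI hE.
pose F (f : {ffun U -> T}) := [ffun x => h (f x)].
have FI : injective F.
  by move=> f g /ffunP fg; apply/ffunP => x; apply: hI; have := fg x; rewrite !ffunE.
rewrite -(card_imset _ FI); apply/subset_leq_card/subsetP => _ /imsetP[f fE ->].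
have /embeddingsP[fI fe] := fE; apply/embeddingsP; split=> [x y|e eH].
  by rewrite !ffunE => /hI /fI.
have -> : F f @: e = h @: (f @: e).
  by rewrite -imset_comp; apply: eq_imset => x; rewrite ffunE.
exact/hE/fe.
Qed.

(** * Neighbourhoods and degrees *)

Section Neighbourhoods.
Variables (T : finType) (G : sgraph T).

Definition nb (u : T) : {set T} := [set v | [set u; v] \in edges G].
Definition deg (u : T) : nat := #|nb u|.

Lemma nb_sym (u v : T) : (v \in nb u) = (u \in nb v).
Proof. by rewrite !inE setUC. Qed.

Lemma nb_irrefl (u v : T) : v \in nb u -> u != v.
Proof.
rewrite inE => uvG; have /forall_inP/(_ _ uvG) := edges_card2 G.
by rewrite cards2; case: (u != v).
Qed.

Lemma card_nbD1 (u v : T) : v \in nb u -> #|nb u :\ v| = (deg u).-1.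
Proof. by move=> uv; rewrite /deg (cardsD1 v (nb u)) uv. Qed.

End Neighbourhoods.

(** * Counting embeddings of a double star *)

Section DoubleStarEmbeddings.
Variables (a b : nat) (T : finType) (G : sgraph T).
Local Notation nb := (nb G).
Local Notation deg := (deg G).

Let code : finType := ((T * T) * ({ffun 'I_a -> T} * {ffun 'I_b -> T}))%type.

Definition dstar_map (p : code) : {ffun dstar_vertex a b -> T} :=
  [ffun x => match x with
             | inl s => if s then p.1.2 else p.1.1
             | inr (inl i) => p.2.1 i
             | inr (inr j) => p.2.2 j
             end].

Lemma dstar_map_bij : bijective dstar_map.
Proof.
exists (fun f : {ffun dstar_vertex a b -> T} => ((f (inl false), f (inl true)),
  ([ffun i => f (inr (inl i))], [ffun j => f (inr (inr j))]))).
  by case=> [[u v] [g h]]; rewrite !ffunE /=; congr (_, (_, _));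
    apply/ffunP => i; rewrite !ffunE.
by move=> f; apply/ffunP => -[[]|[i|j]]; rewrite !ffunE /= ?ffunE.
Qed.

Definition leaves_at (k : nat) (R : {set T}) : {set {ffun 'I_k -> T}} :=
  [set g : {ffun 'I_k -> T} in ffun_on (mem R) | injectiveb g].

Lemma card_leaves_at k (R : {set T}) : #|leaves_at k R| = #|R| ^_ k.
Proof. by rewrite card_inj_ffuns_on card_ord. Qed.

Lemma leaves_atP k (R : {set T}) (g : {ffun 'I_k -> T}) :
  reflect (injective g /\ forall i, g i \in R) (g \in leaves_at k R).
Proof.
rewrite inE; apply: (iffP andP) => -[].
  by move=> /ffun_onP gR /injectiveP gI.
by move=> gI gR; split; [apply/ffun_onP | apply/injectiveP].
Qed.

(** Adjacency already separates a leaf from its own centre. The set differences exclude the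
    remaining collisions: a leaf with the opposite centre, or two leaves at different centres. *)
Lemma dstar_map_embedding (p : code) :
  (dstar_map p \in embeddings (dstar a b) G) =
  [&& p.1.2 \in nb p.1.1, p.2.1 \in leaves_at a (nb p.1.1 :\ p.1.2)
    & p.2.2 \in leaves_at b (nb p.1.2 :\ p.1.1 :\: p.2.1 @: setT)].
Proof.
case: p => [[u v] [g h]] /=; apply/embeddingsP/and3P.
  set f := dstar_map _ => -[fI fE].
  have fuv : [set u; v] \in edges G.
    by have := fE [set inl false; inl true]; rewrite imsetU1 imset_set1 !ffunE;
      apply; rewrite !inE eqxx.
  have fg i : [set u; g i] \in edges G.
    have := fE [set inl false; inr (inl i)]; rewrite imsetU1 imset_set1 !ffunE.
    by apply; apply/setU1P; right; apply/setUP; left; apply/imsetP; exists i.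
  have fh j : [set v; h j] \in edges G.
    have := fE [set inl true; inr (inr j)]; rewrite imsetU1 imset_set1 !ffunE.
    by apply; apply/setU1P; right; apply/setUP; right; apply/imsetP; exists j.
  split; first by rewrite inE.
    apply/leaves_atP; split=> [i j ij|i].
      by have := fI (inr (inl i)) (inr (inl j)); rewrite !ffunE => /(_ ij)[].
    rewrite !inE fg andbT; apply/eqP => giv.
    by have := fI (inr (inl i)) (inl true); rewrite !ffunE => /(_ giv).
  apply/leaves_atP; split=> [i j ij|i].
    by have := fI (inr (inr i)) (inr (inr j)); rewrite !ffunE => /(_ ij)[].
  rewrite !inE fh andbT; apply/andP; split.
    apply/imsetP => -[j _ hg].
    by have := fI (inr (inr i)) (inr (inl j)); rewrite !ffunE => /(_ hg).
  apply/eqP => hiu.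
  by have := fI (inr (inr i)) (inl false); rewrite !ffunE => /(_ hiu).
case=> uv /leaves_atP[gI gR] /leaves_atP[hI hR].
have uNv := nb_irrefl uv.
have gv i : g i != v by have := gR i; rewrite !inE => /andP[].
have gE i : [set u; g i] \in edges G by have := gR i; rewrite !inE => /andP[].
have gu i : g i != u.
  by rewrite eq_sym; apply: (@nb_irrefl _ G); rewrite inE.
have hu j : h j != u by have := hR j; rewrite !inE => /and3P[].
have hE j : [set v; h j] \in edges G by have := hR j; rewrite !inE => /and3P[].
have hv j : h j != v.
  by rewrite eq_sym; apply: (@nb_irrefl _ G); rewrite inE.
have gh i j : g i != h j.
  apply/eqP => gihj; have := hR j; rewrite !inE => /and3P[/negP[]].
  by rewrite -gihj imset_f.
split.
  have vNu : v != u by rewrite eq_sym.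
  have hg j i : h j != g i by rewrite eq_sym.
  have vg i : v != g i by rewrite eq_sym.
  have ug i : u != g i by rewrite eq_sym.
  have vh i : v != h i by rewrite eq_sym.
  have uh i : u != h i by rewrite eq_sym.
  move=> [[]|[i|j]] [[]|[i'|j']]; rewrite !ffunE //=;
    by [ move/gI -> | move/hI -> | move/eqP => E; exfalso; move: E; apply/negP ].
move=> e; rewrite !inE => /orP[/eqP->|/orP[]/imsetP[i _ ->]];
  rewrite imsetU1 imset_set1 !ffunE //=.
by move: uv; rewrite inE.
Qed.

Lemma card_dstar_embeddings :
  #|embeddings (dstar a b) G| =
  \sum_u \sum_(v in nb u) \sum_(g in leaves_at a (nb u :\ v))
     #|nb v :\ u :\: g @: setT| ^_ b.
Proof.
have [dinv dK dK'] := dstar_map_bij.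
rewrite -sum1_card (reindex dstar_map) /=; last first.
  by exists dinv => x _; [apply: dK | apply: dK'].
under eq_bigl => p do rewrite dstar_map_embedding.
rewrite pair_big_dep /= -(pair_big_dep (fun p : T * T => p.2 \in nb p.1)
  (fun p q => (q.1 \in leaves_at a (nb p.1 :\ p.2)) &&
    (q.2 \in leaves_at b (nb p.2 :\ p.1 :\: q.1 @: setT))) (fun _ _ => 1)) /=.
apply: eq_bigr => -[u v] /= uv.
rewrite -(pair_big_dep (fun g => g \in leaves_at a (nb u :\ v))
    (fun g h => h \in leaves_at b (nb v :\ u :\: g @: setT)) (fun _ _ => 1)) /=.
by apply: eq_bigr => g _; rewrite sum1_card card_leaves_at.
Qed.

(** Overcounts by letting the leaves at [v] meet those at [u]. *)
Lemma card_dstar_embeddings_le :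
  #|embeddings (dstar a b) G| <=
  \sum_u \sum_(v in nb u) (deg u).-1 ^_ a * (deg v).-1 ^_ b.
Proof.
rewrite card_dstar_embeddings; apply: leq_sum => u _; apply: leq_sum => v uv.
rewrite -(card_nbD1 uv) -card_leaves_at -sum_nat_const; apply: leq_sum => g _.
rewrite -card_leaves_at -(@card_nbD1 _ _ v u) 1?nb_sym //.
rewrite -card_leaves_at; apply/subset_leq_card/subsetP => h.
move=> /leaves_atP[hI hR]; apply/leaves_atP; split=> // i.
by have := hR i; rewrite inE => /andP[].
Qed.

(** The leaves chosen at [u] lie outside [nb v], so deleting them costs nothing. *)
Lemma card_dstar_embeddings_triangle_free :
  (forall u v, v \in nb u -> [disjoint nb u & nb v]) ->
  #|embeddings (dstar a b) G| =
  \sum_u \sum_(v in nb u) (deg u).-1 ^_ a * (deg v).-1 ^_ b.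
Proof.
move=> tf; rewrite card_dstar_embeddings; apply: eq_bigr => u _.
apply: eq_bigr => v uv.
rewrite -(card_nbD1 uv) -card_leaves_at -sum_nat_const; apply: eq_bigr => g.
case/leaves_atP=> _ gR; congr (_ ^_ b).
rewrite -(@card_nbD1 _ _ v u) 1?nb_sym //; congr #|pred_of_set _|.
apply/setDidPl; rewrite disjoint_sym disjoint_subset.
apply/subsetP => _ /imsetP[i _ ->]; rewrite !inE negb_and negbK.
have := gR i; rewrite in_setD1 => /andP[_ giu].
by have /disjointFr/(_ giu) := tf _ _ uv; rewrite inE => ->; rewrite orbT.
Qed.

(* Choosing the leaves at [u] first costs [v] at most [a] of its neighbours. *)
Lemma dstar_embedding_exists (u v : T) :
  v \in nb u -> a < deg u -> a + b < deg v -> 0 < #|embeddings (dstar a b) G|.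
Proof.
move=> uv au bv; rewrite card_dstar_embeddings.
have : 0 < #|leaves_at a (nb u :\ v)|.
  by rewrite card_leaves_at card_nbD1 // ffact_gt0; lia.
case/card_gt0P=> g gL.
rewrite (bigD1 u) //= (bigD1 v) //= (bigD1 g) //= !addn_gt0 ffact_gt0.
suff -> : b <= #|nb v :\ u :\: g @: setT| by [].
have := leq_imset_card g setT; rewrite cardsT card_ord.
have := subset_leq_card (subsetIr (nb v :\ u) (g @: setT)).
by rewrite cardsD card_nbD1 1?nb_sym //; lia.
Qed.

End DoubleStarEmbeddings.

(** * Falling factorials and the weight of an edge *)

Lemma leq_ffact2r (k m n : nat) : m <= n -> m ^_ k <= n ^_ k.
Proof.
elim: k m n => [//|k IHk] m n mn; rewrite !ffactnS.
by apply: leq_mul => //; apply: IHk; lia.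
Qed.

Lemma ffact_leq_exp (n k : nat) : n ^_ k <= n ^ k.
Proof.
elim: k n => [//|k IHk] n; rewrite ffactnS expnS leq_mul2l.
apply/orP; right; apply: leq_trans (IHk _) _.
by case: k {IHk} => // k; rewrite leq_exp2r //; lia.
Qed.

Lemma leq_ffact_pos (n k : nat) : 0 < k <= n -> n <= n ^_ k.
Proof.
case: k => // k /= kn; rewrite ffactnS leq_pmulr // ffact_gt0; lia.
Qed.

(* Number of embeddings of [S_{a,b}] using a given edge of [K_{c,q}]. *)
Definition edge_weight (a b c q : nat) : nat :=
  c.-1 ^_ a * q.-1 ^_ b + c.-1 ^_ b * q.-1 ^_ a.

Lemma leq_edge_weight a b c q q' : q <= q' ->
  edge_weight a b c q <= edge_weight a b c q'.
Proof.
move=> qq'; rewrite /edge_weight.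
by apply: leq_add; apply: leq_mul => //; apply: leq_ffact2r; lia.
Qed.

(** The first summand suffices: [a < c] makes [c.-1 ^_ a] positive and [0 < b] makes [q.-1 ^_ b] at
    least linear in [q]. *)
Lemma edge_weight_ge a b c q : a < c -> 0 < b -> b < q ->
  q.-1 <= edge_weight a b c q.
Proof.
move=> ac b0 bq; apply: leq_trans (leq_addr _ _).
apply: leq_trans (leq_pmull _ _); first by apply: leq_ffact_pos; lia.
by rewrite ffact_gt0; lia.
Qed.

(** * The extremal graph *)

Section CompleteBipartite.
Variables (m k : nat).
Local Notation K := (Kbip m k).

Lemma nb_Kbip_l i : nb K (inl i) = inr @: setT.
Proof.
apply/setP => -[j|j]; rewrite inE; apply/imset2P/imsetP.
- case=> x y _ _ /setP/(_ (inr y)); by rewrite !in_set2 eqxx orbT.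
- by case.
- by move=> _; exists j; rewrite ?inE.
- by case=> j' _ [->]; exists i j'.
Qed.

Lemma nb_Kbip_r j : nb K (inr j) = inl @: setT.
Proof.
apply/setP => -[i|i]; rewrite nb_sym.
  by rewrite nb_Kbip_l !imset_f.
rewrite inE; apply/imset2P/imsetP.
  case=> x y _ _ /setP/(_ (inl x)); by rewrite !in_set2 eqxx.
by case.
Qed.

Lemma deg_Kbip_l i : deg K (inl i) = k.
Proof.
by rewrite /deg nb_Kbip_l card_imset ?cardsT ?card_ord // => x y [].
Qed.

Lemma deg_Kbip_r j : deg K (inr j) = m.
Proof.
by rewrite /deg nb_Kbip_r card_imset ?cardsT ?card_ord // => x y [].
Qed.

Lemma Kbip_triangle_free u v : v \in nb K u -> [disjoint nb K u & nb K v].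
Proof.
case: u => [i|j]; rewrite ?nb_Kbip_l ?nb_Kbip_r => /imsetP[x _ ->];
  rewrite ?nb_Kbip_l ?nb_Kbip_r disjoint_subset;
  by apply/subsetP => _ /imsetP[y _ ->]; rewrite inE; apply/imsetP => -[].
Qed.

Lemma card_dstar_embeddings_Kbip a b :
  #|embeddings (dstar a b) K| = m * k * edge_weight a b m k.
Proof.
rewrite (card_dstar_embeddings_triangle_free _ _ Kbip_triangle_free).
rewrite big_sumType /=.
have -> : \sum_(i < m) \sum_(v in nb K (inl i))
    (deg K (inl i)).-1 ^_ a * (deg K v).-1 ^_ b
    = m * (k * (k.-1 ^_ a * m.-1 ^_ b)).
  rewrite -[in RHS](card_ord m) -sum_nat_const; apply: eq_bigr => i _.
  rewrite -[k in RHS](deg_Kbip_l i) -sum_nat_const; apply: eq_bigr => v.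
  by rewrite nb_Kbip_l => /imsetP[j _ ->]; rewrite deg_Kbip_l deg_Kbip_r card_ord.
have -> : \sum_(j < k) \sum_(v in nb K (inr j))
    (deg K (inr j)).-1 ^_ a * (deg K v).-1 ^_ b
    = k * (m * (m.-1 ^_ a * k.-1 ^_ b)).
  rewrite -[in RHS](card_ord k) -sum_nat_const; apply: eq_bigr => j _.
  rewrite -[m in RHS](deg_Kbip_r j) -sum_nat_const; apply: eq_bigr => v.
  by rewrite nb_Kbip_r => /imsetP[i _ ->]; rewrite deg_Kbip_l deg_Kbip_r card_ord.
rewrite /edge_weight; nia.
Qed.

(** One centre would lie on the side of size [k], where vertices have degree [m], leaving it only
    [m.-1] candidate leaves, fewer than [c] and [d]. *)
Lemma Kbip_copy_free c d : m <= c -> m <= d -> 0 < m ->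
  copy_free (dstar c d) K.
Proof.
move=> mc md m0; rewrite copy_freeE card_dstar_embeddings_Kbip /edge_weight.
by rewrite !(@ffact_small m.-1) ?mul0n ?muln0 //; lia.
Qed.
End CompleteBipartite.

(** * Upper bounds in a graph free of [S_{c,d}] *)

Section UpperBound.
Variables (a b c d : nat) (T : finType) (G : sgraph T).
Local Notation nb := (nb G).
Local Notation deg := (deg G).
Hypothesis Gfree : copy_free (dstar c d) G.

Definition big_vertices := [set v : T | c + d < deg v].
Local Notation B := big_vertices.
Local Notation q := #|~: B|.

Lemma deg_nb_big u v : v \in nb u -> v \in B -> deg u <= c.
Proof.
move=> uv; rewrite inE => vB; move: Gfree; rewrite copy_freeE leqNgt.
by apply: contraL => cu; rewrite -lt0n; apply: (dstar_embedding_exists uv).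
Qed.

Lemma nb_big v : v \in B -> nb v \subset ~: B.
Proof.
move=> vB; apply/subsetP => u; rewrite nb_sym => uv.
by have := deg_nb_big uv vB; rewrite !inE -leqNgt; lia.
Qed.

Lemma deg_big v : v \in B -> deg v <= q.
Proof. by move=> vB; apply/subset_leq_card/nb_big. Qed.

(** Big vertices are independent, so every ordered edge leaving one can be moved to its small end.
    An edge between small vertices stays split between its ends. *)
Lemma sum_edges_small (w : T -> T -> nat) :
  \sum_u \sum_(v in nb u) w u v =
  \sum_(u in ~: B) (\sum_(v in nb u :&: B) (w u v + w v u) +
                    \sum_(v in nb u :\: B) w u v).
Proof.
rewrite (bigID [in B]) /=.
have -> : \sum_(u in B) \sum_(v in nb u) w u v =
          \sum_(v in ~: B) \sum_(u in nb v :&: B) w u v.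
  rewrite (exchange_big_dep [in ~: B]) /=; last first.
    by move=> u v uB; apply/subsetP/nb_big.
  apply: eq_bigr => v _; apply: eq_bigl => u.
  by rewrite in_setI nb_sym andbC.
rewrite [X in _ + X](eq_bigl [in ~: B]); last by move=> u; rewrite !inE.
rewrite -big_split; apply: eq_bigr => u _ /=.
rewrite [X in _ + X = _](big_setID B) /= big_split /= addnA.
by rewrite [X in X + _]addnC.
Qed.

Lemma vertex_weight_le u : u \notin B ->
  \sum_(v in nb u :&: B)
     ((deg u).-1 ^_ a * (deg v).-1 ^_ b + (deg v).-1 ^_ a * (deg u).-1 ^_ b)
  + \sum_(v in nb u :\: B) (deg u).-1 ^_ a * (deg v).-1 ^_ b
  <= #|nb u :&: B| * edge_weight a b c q
     + (deg u - #|nb u :&: B|) * (c + d) ^ (a + b).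
Proof.
move=> uS; apply: leq_add.
  rewrite -sum_nat_const; apply: leq_sum => v /setIP[uv vB].
  have du := deg_nb_big uv vB; have dv := deg_big vB.
  rewrite /edge_weight [X in _ + X <= _]mulnC.
  by apply: leq_add; apply: leq_mul; apply: leq_ffact2r; lia.
rewrite -cardsD -sum_nat_const; apply: leq_sum => v /setDP[uv vS].
move: uS vS; rewrite !inE -!leqNgt => uS vS.
rewrite expnD; apply: leq_mul.
  apply: leq_trans (leq_ffact2r _ (_ : _ <= c + d)) (ffact_leq_exp _ _); lia.
apply: leq_trans (leq_ffact2r _ (_ : _ <= c + d)) (ffact_leq_exp _ _); lia.
Qed.

Local Notation W := (edge_weight a b c q).
Local Notation D := ((c + d) ^ (a + b)).

Lemma card_embeddings_le (r : nat) : (forall u, #|nb u :&: B| <= r) ->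
  #|embeddings (dstar a b) G| <= q * (r * W + (c + d) * D).
Proof.
move=> hr; apply: leq_trans (card_dstar_embeddings_le _ _ _) _.
rewrite sum_edges_small -sum_nat_const; apply: leq_sum => u uS.
apply: leq_trans (vertex_weight_le _) _; first by rewrite -in_setC.
apply: leq_add; first by rewrite leq_mul2r hr orbT.
by move: uS; rewrite !inE -leqNgt => uS; rewrite leq_mul2r; apply/orP; right; lia.
Qed.

Lemma card_nbI_big u : #|nb u :&: B| <= c.
Proof.
case: (set_0Vmem (nb u :&: B)) => [->|[v /setIP[uv vB]]]; first by rewrite cards0.
exact: leq_trans (subset_leq_card (subsetIl _ _)) (deg_nb_big uv vB).
Qed.

(** If [u] has a big neighbour, then [deg u <= c] and each edge at [u] costs at most [W]. Otherwise
    its at most [c + d] edges together cost at most [(c + d) * D], hence at most [W]. *)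
Lemma card_embeddings_le_sharp : 0 < c -> (c + d) * D <= W ->
  #|embeddings (dstar a b) G| <= q * (c * W).
Proof.
move=> c0 DW; apply: leq_trans (card_dstar_embeddings_le _ _ _) _.
rewrite sum_edges_small -sum_nat_const; apply: leq_sum => u uS.
apply: leq_trans (vertex_weight_le _) _; first by rewrite -in_setC.
case: (set_0Vmem (nb u :&: B)) => [->|[v /setIP[uv vB]]].
  rewrite cards0 mul0n subn0 add0n; move: uS; rewrite !inE -leqNgt => uS.
  apply: leq_trans (leq_pmull _ c0); apply: leq_trans DW.
  by rewrite leq_mul2r uS orbT.
have du := deg_nb_big uv vB.
have rdu : #|nb u :&: B| <= deg u by apply: subset_leq_card; apply: subsetIl.
have DW' : D <= W by apply: leq_trans DW; rewrite leq_pmull //; lia.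
apply: leq_trans (leq_add (leqnn _) (leq_mul (leqnn _) DW')) _.
by rewrite -mulnDl leq_mul2r; apply/orP; right; lia.
Qed.

End UpperBound.

(** * Numerical comparison for large [n] *)

(** The ratio of the two falling factorials is exactly [n / (n - j)]. *)
Lemma ffact_pred_ratio (p j n : nat) : p.+1 * j < n ->
  p * n ^_ j <= p.+1 * n.-1 ^_ j.
Proof.
move=> hn; have nj : 0 < n - j by nia.
have := ffactnSr n j; rewrite ffactnS => E.
rewrite -(leq_pmul2r nj) -mulnA -E; nia.
Qed.

Lemma ffact_sub_ratio (p c j n : nat) : 0 < c -> (p.+1 * c).+1 * j + c < n ->
  p * n ^_ j <= p.+1 * (n - c) ^_ j.
Proof.
move=> c0 hn; rewrite -(leq_pmul2r c0) mulnAC [leqRHS]mulnAC mulSnr.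
(* The ratio [(p + 1) / p] is a product of [c] factors [(p * c + i + 1) / (p * c + i)], one for each
   unit decrease of [n]. *)
suff telescope i : i <= c -> p * c * n ^_ j <= (p * c + i) * (n - i) ^_ j.
  exact: telescope.
elim: i => [|i IHi] ic; first by rewrite addn0 subn0.
apply: leq_trans (IHi (ltnW ic)) _; rewrite addnS subnS.
by apply: ffact_pred_ratio; nia.
Qed.

(** Absorbing [q] yields pure falling factorials of [q], to which the ratio bound applies
    termwise. *)
Lemma mul_edge_weight a b c q :
  q * edge_weight a b c q = c.-1 ^_ a * q ^_ b.+1 + c.-1 ^_ b * q ^_ a.+1.
Proof. by rewrite /edge_weight !ffactnS; nia. Qed.

(* The passage from [n] to [n - c] costs a factor tending to 1, which together
   with the linear term [n * K] is absorbed by the gap between [c - 1] and [c]. *)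
Lemma few_big_bound a b c K : a < c -> a <= b -> 0 < b ->
  exists n0, forall n, n0 <= n ->
    n * (c.-1 * edge_weight a b c n + K)
      <= (n - c) * (c * edge_weight a b c (n - c)).
Proof.
(* With this [p], [c - 1] times the ratio [(p + 1) / p] is [c - 1/2] when [c > 1]. The other half of
   [(n - c) * W (n - c)] is left to absorb [n * K]. *)
move=> ac ab b0; pose p := c.-1 * 2.
exists ((p.+1 * c).+1 * b.+1 + c + c + b + 4 * K + 4) => n hn.
set W := edge_weight a b c.
have ratio : p * (n * W n) <= p.+1 * ((n - c) * W (n - c)).
  rewrite !mul_edge_weight !mulnDr; apply: leq_add;
    rewrite mulnCA [leqRHS]mulnCA leq_mul2l; apply/orP; right;
    apply: ffact_sub_ratio; nia.
have Wge : (n - c).-1 <= W (n - c) by apply: edge_weight_ge; lia.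
have lin : n * K * 2 <= (n - c) * W (n - c).
  apply: leq_trans (leq_mul (leqnn _) Wge); nia.
move: ratio lin; rewrite /p; move: (W n) (W (n - c)) => x y.
case: c ac {hn W Wge p} => // c _ /=; nia.
Qed.

(** Bounded weight forces bounded [q], so the left side is bounded while the right side grows with
    [n]. *)
Lemma many_big_bound a b c K : a < c -> 0 < b ->
  exists n0, forall n q, n0 <= n -> q <= n - c ->
    edge_weight a b c q < K ->
    q * (c * edge_weight a b c q + K)
      <= (n - c) * (c * edge_weight a b c (n - c)).
Proof.
move=> ac b0; exists (c + b + (b + K).+1 * (2 * K) + 2) => n q hn qn WK.
have qs : q <= (b + K).+1.
  case: (leqP q b) => [|bq]; first lia.
  by have := edge_weight_ge ac b0 bq; lia.
have Wge : (n - c).-1 <= edge_weight a b c (n - c) by apply: edge_weight_ge; lia.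
set x := edge_weight a b c q in WK *.
(* Since [x < K] and [1 <= c], the factor [c * x + K] is at most [2 * K * c]. *)
apply: (@leq_trans ((b + K).+1 * (2 * K) * c)); last first.
  rewrite [leqRHS]mulnA; apply: leq_trans (leq_pmulr _ _); last lia.
  rewrite leq_mul2r; apply/orP; right; lia.
rewrite -mulnA; apply: leq_mul => //; nia.
Qed.

(** * Moving the extremal graph onto the vertex type ['I_n] *)

Lemma ord_sum_bij m n : m <= n ->
  exists h : 'I_m + 'I_(n - m) -> 'I_n, bijective h.
Proof.
move=> mn; exists (fun x => cast_ord (subnKC mn) (unsplit x)).
exists (fun i => split (cast_ord (esym (subnKC mn)) i)) => x.
  by rewrite cast_ordK unsplitK.
by rewrite splitK cast_ordKV.
Qed.

Section Transport.
Variables (T T' : finType) (G : sgraph T) (h : T -> T') (hI : injective h).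

Lemma transport_card2 :
  [forall e in [set h @: e | e : {set T} in edges G], #|e| == 2].
Proof.
apply/forall_inP => _ /imsetP[e eG ->]; rewrite card_imset //.
by have /forall_inP/(_ _ eG) := edges_card2 G.
Qed.

Definition transport : sgraph T' := SGraph transport_card2.

Lemma card_embeddings_transport (U : finType) (H : sgraph U) : bijective h ->
  #|embeddings H transport| = #|embeddings H G|.
Proof.
case=> k hK kK; apply/eqP; rewrite eqn_leq; apply/andP; split.
  apply: (leq_embeddings _ (can_inj kK)) => _ /imsetP[e eG ->].
  by rewrite -imset_comp (eq_imset _ hK) imset_id.
by apply: (leq_embeddings _ hI) => e eG; apply: imset_f.
Qed.

End Transport.

Theorem theorem1p7 (a b c d : nat) (hab : a <= b) (hac : a < c) (hcd : c <= d)
    (hb : 0 < b) :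
  exists n0 : nat, forall n : nat, n0 <= n ->
    gen_ex n (dstar a b) (dstar c d) = ncopies (dstar a b) (Kbip c (n - c)).
Proof.
(* This bounds the total contribution at a small vertex of its edges to small neighbours. *)
pose K := (c + d) * (c + d) ^ (a + b).
have [n1 few] := few_big_bound K hac hab hb.
have [n2 many] := many_big_bound K hac hb.
have c0 : 0 < c by lia.
exists (c + n1 + n2) => n hn; have cn : c <= n by lia.
apply/eqP; rewrite eqn_leq; apply/andP; split.
  apply/bigmax_leqP => G Gfree.
  rewrite -(leq_pmul2r (automorphisms_gt0 (dstar a b))).
  rewrite !ncopies_mul_automorphisms card_dstar_embeddings_Kbip.
  rewrite [leqRHS](_ : _ = (n - c) * (c * edge_weight a b c (n - c))); last by lia.
  pose B := big_vertices c d G.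
  have qn : #|~: B| + #|B| = n by rewrite addnC cardsC card_ord.
  case: (leqP c #|B|) => [cB|Bc].
    have qm : #|~: B| <= n - c by lia.
    (* Large weight allows the bound without error term; small weight bounds the number of small
       vertices. *)
    case: (leqP K (edge_weight a b c #|~: B|)) => KW.
      apply: leq_trans (card_embeddings_le_sharp Gfree c0 KW) _.
      by apply: leq_mul => //; apply: leq_mul => //; apply: leq_edge_weight.
    apply: leq_trans (card_embeddings_le _ _ Gfree (card_nbI_big Gfree)) _.
    by apply: many => //; lia.
  have hr u : #|nb G u :&: B| <= c.-1.
    by have := subset_leq_card (subsetIr (nb G u) B); lia.
  apply: leq_trans (card_embeddings_le _ _ Gfree hr) _.
  (* Here only [#|~: B| <= n] is available; the gain comes from [c.-1] in place of [c]. *)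
  apply: leq_trans (few n _); last by lia.
  have qle : #|~: B| <= n by lia.
  apply: leq_mul => //; rewrite leq_add2r; apply: leq_mul => //.
  exact: leq_edge_weight.
have [h hbij] := ord_sum_bij cn.
pose G := transport (Kbip c (n - c)) (bij_inj hbij).
have Gfree : copy_free (dstar c d) G.
  rewrite copy_freeE card_embeddings_transport // -copy_freeE.
  exact: Kbip_copy_free.
apply: leq_trans (leq_bigmax_cond G Gfree).
rewrite -(leq_pmul2r (automorphisms_gt0 (dstar a b))).
by rewrite !ncopies_mul_automorphisms card_embeddings_transport.
Qed.
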